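(* Fix an integer $s\ge 1$, $\alpha\in(0,1)$, and $q\in(0,1)$. Then there exists an $(s,\alpha,0)$-OSI $\Omega$ (that is, for some integers $n\ge s$ and $k\ge1$, a random matrix $\Omega\in\mathbb{R}^{n\times k}$ that is an $(s,\alpha,0)$-OSI) such that \[ \mathbb{P}\left\{\sup_{x\neq 0}\frac{\|\Omega^\top x\|_2^2}{\|x\|_2^2}=\alpha+\frac{s(1-\alpha)}{q}\right\}= q , \] where the supremum is over nonzero $x\in\mathbb{R}^n$.
   Context: Definition (oblivious subspace injection, OSI). Fix integers $1\le s\le n$ and $k\ge1$, an injectivity parameter $\alpha\in(0,1]$, and a failure parameter $\rho\in[0,1)$. A random matrix $\Omega\in\mathbb{R}^{n\times k}$ is an $(s,\alpha,\rho)$-OSI if (i) (isotropy) $\mathbb{E}[\Omega\Omega^\top]=I_n$; and (ii) (injectivity) for every fixed $s$-dimensional subspace $V\subseteq\mathbb{R}^n$, $\mathbb{P}\{\|\Omega^\top x\|_2^2\ge\alpha\|x\|_2^2\text{ for all }x\in V\}\ge1-\rho$. *)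

(* Defs.v *)
From HB Require Import structures.
From mathcomp Require Import all_boot all_order all_algebra.
From mathcomp Require Import all_classical all_reals all_analysis.
Set Implicit Arguments.
Unset Strict Implicit.
Unset Printing Implicit Defensive.
Import Order.TTheory GRing.Theory Num.Theory.
Local Open Scope classical_set_scope.
Local Open Scope ring_scope.

(* The library norm `|x| on matrices is the max norm, hence this definition. *)
Definition l2norm (R : realType) (n : nat) (x : 'cV[R]_n) : R :=
  Num.sqrt (\sum_i x i 0 ^+ 2).

Definition random_matrix d (T : measurableType d) (R : realType) (n k : nat)
    (Omega : T -> 'M[R]_(n, k)) : Prop :=
  forall i j, measurable_fun [set: T] (fun w => Omega w i j).

(* An expectation equal to 1 on the diagonal makes the entries of Omega
   square-integrable, so all the expectations below are of integrable
   random variables. *)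
Definition isotropic d (T : measurableType d) (R : realType)
    (P : probability T R) (n k : nat) (Omega : T -> 'M[R]_(n, k)) : Prop :=
  forall i j, ('E_P[fun w => (Omega w *m (Omega w)^T) i j]
               = ((1%:M : 'M[R]_n) i j)%:E)%E.

(* For a random matrix the event below is measurable, since V may be replaced
   with a countable dense subset. *)
Definition injective_on_subspaces d (T : measurableType d) (R : realType)
    (P : probability T R) (n k : nat) (s : nat) (alpha rho : R)
    (Omega : T -> 'M[R]_(n, k)) : Prop :=
  forall V : {vspace 'cV[R]_n}, \dim V = s ->
    ((1 - rho)%:E <=
     P [set w | forall x : 'cV[R]_n, x \in V ->
          (alpha * l2norm x ^+ 2 <= l2norm ((Omega w)^T *m x) ^+ 2)%R])%E.

Definition OSI d (T : measurableType d) (R : realType)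
    (P : probability T R) (n k : nat) (s : nat) (alpha rho : R)
    (Omega : T -> 'M[R]_(n, k)) : Prop :=
  [/\ [/\ (1 <= s <= n)%N, (1 <= k)%N, 0 < alpha <= 1 & 0 <= rho < 1],
      random_matrix Omega,
      isotropic P Omega &
      injective_on_subspaces P s alpha rho Omega].

(* Main.v *)
(* Take n = k = s and let Omega be diagonal, so that Omega Omega^T is also
   diagonal.  With probability 1 - q it equals alpha I, and with probability q
   it equals alpha I plus s (1 - alpha) / q times the projection on a uniformly
   chosen coordinate axis.  Each diagonal entry then has mean
   alpha + (q / s) (s (1 - alpha) / q) = 1, the matrix always dominates
   alpha I, and its top eigenvalue is alpha + s (1 - alpha) / q exactly when a
   coordinate is chosen. *)

Require Import Defs.
From HB Require Import structures.
From mathcomp Require Import all_boot all_order all_algebra.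
From mathcomp Require Import all_classical all_reals all_analysis.
From mathcomp Require Import measurable_realfun.
Import Order.TTheory GRing.Theory Num.Theory.
Local Open Scope classical_set_scope.
Local Open Scope ring_scope.

(** The measure is the sum of the Dirac masses at [x k] weighted by [p k]. Since [f] is nonnegative,
    its integral splits over this sum without any integrability check. *)
Lemma finitely_supported_probability (d : measure_display)
    (T : measurableType d) (R : realType) (n : nat) (x : nat -> T)
    (p : nat -> R) :
    (forall k, 0 <= p k) -> \sum_(k < n) p k = 1 ->
  exists P : probability T R,
    (forall A, P A = (\sum_(k < n) p k * (x k \in A)%:R)%:E) /\
    (forall f : T -> R, measurable_fun [set: T] f -> (forall t, 0 <= f t) ->
       ('E_P[f] = (\sum_(k < n) p k * f (x k))%:E)%E).
Proof.
move=> p0 p1.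
pose m k := mscale (NngNum (p0 k)) (\d_(x k)) : measure T R.
pose mu := msum m n.
have muE A : mu A = (\sum_(k < n) p k * (x k \in A)%:R)%:E.
  by rewrite -sumEFin; apply: eq_bigr => k _; rewrite EFinM -diracE.
have mu1 : mu [set: T] = 1%E.
  by rewrite muE; under eq_bigr do rewrite in_setT mulr1; rewrite p1.
pose isP := Measure_isProbability.Build _ _ _ mu mu1.
pose P : probability T R := HB.pack mu isP.
exists P; split=> [//|f mf f0].
have /measurable_EFinP mEf := mf.
rewrite unlock ge0_integral_measure_sum//=; last first.
  by move=> t _; rewrite lee_fin.
rewrite -sumEFin; apply: eq_bigr => k _.
rewrite ge0_integral_mscale//=; last by move=> t _; rewrite lee_fin.
by rewrite integral_dirac//= diracT mul1e EFinM.
Qed.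

Section diagonal.
Context {R : realType} {n : nat}.
Implicit Types (a : 'I_n -> R) (x : 'cV[R]_n).

(** Parametrised by the intended eigenvalues [a] of the product with the transpose, hence the square
    roots. *)
Definition sqrt_diag a : 'M[R]_n := diag_mx (\row_i Num.sqrt (a i)).

Lemma sqrt_diag_mul_tr a (a0 : forall i, 0 <= a i) i j :
  (sqrt_diag a *m (sqrt_diag a)^T) i j = a i *+ (i == j).
Proof.
rewrite tr_diag_mx mulmx_diag !mxE.
case: eqP => [->|_]; last by rewrite !mulr0n.
by rewrite !mulr1n -expr2 sqr_sqrtr.
Qed.

Lemma l2norm_sqr x : l2norm x ^+ 2 = \sum_i x i 0 ^+ 2.
Proof. by rewrite sqr_sqrtr// sumr_ge0// => i _; exact: sqr_ge0. Qed.

Lemma l2norm_sqrt_diag a (a0 : forall i, 0 <= a i) x :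
  l2norm ((sqrt_diag a)^T *m x) ^+ 2 = \sum_i a i * x i 0 ^+ 2.
Proof.
rewrite l2norm_sqr tr_diag_mx mul_diag_mx; apply: eq_bigr => i _.
by rewrite !mxE exprMn sqr_sqrtr.
Qed.

Lemma l2norm_sqr_gt0 x : x != 0 -> 0 < l2norm x ^+ 2.
Proof.
move=> x0.
rewrite lt_def l2norm_sqr sumr_ge0 ?andbT => [|i _]; last exact: sqr_ge0.
apply: contra x0; rewrite psumr_eq0 => [/allP h|i _]; last exact: sqr_ge0.
apply/eqP/matrixP => i j; rewrite ord1 mxE.
by have := h i (mem_index_enum i); rewrite sqrf_eq0 => /eqP.
Qed.

(** The quotient is an average of the [a i] with weights proportional to [x i 0 ^+ 2], so it is at
    most [a m]; the basis vector [delta_mx m 0] attains this bound. *)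
Lemma sup_rayleigh_sqrt_diag a (a0 : forall i, 0 <= a i) (m : 'I_n) :
    (forall i, a i <= a m) ->
  ereal_sup [set (l2norm ((sqrt_diag a)^T *m x) ^+ 2 / l2norm x ^+ 2)%:E
            | x in [set x : 'cV[R]_n | x != 0]] = (a m)%:E.
Proof.
move=> am; apply/eqP; rewrite eq_le; apply/andP; split.
  apply/ereal_supP => _ [x /= x0 <-].
  rewrite lee_fin ler_pdivrMr ?l2norm_sqr_gt0// l2norm_sqrt_diag// l2norm_sqr.
  by rewrite mulr_sumr ler_sum// => i _; rewrite ler_wpM2r ?sqr_ge0.
apply: ereal_sup_ubound; exists (delta_mx m 0) => /=.
  by apply/eqP => /matrixP/(_ m 0)/eqP; rewrite !mxE !eqxx oner_eq0.
rewrite l2norm_sqrt_diag// l2norm_sqr (bigD1 m)//= [X in _ / X](bigD1 m)//=.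
rewrite !big1 => [|i /negbTE im|i /negbTE im]; rewrite !mxE ?im ?eqxx/=.
- by rewrite !addr0 expr1n mulr1 divr1.
- by rewrite expr0n.
- by rewrite expr0n mulr0.
Qed.

End diagonal.

Theorem proposition2p2 (R : realType) (s : nat) (alpha q : R)
    (hs : (1 <= s)%N) (halpha : 0 < alpha < 1) (hq : 0 < q < 1) :
  exists (d : measure_display) (T : measurableType d) (P : probability T R)
         (n k : nat) (Omega : T -> 'M[R]_(n, k)),
    OSI P s alpha 0 Omega /\
    P [set w | ereal_sup [set (l2norm ((Omega w)^T *m x) ^+ 2
                               / l2norm x ^+ 2)%:E
                         | x in [set x : 'cV[R]_n | x != 0]]
               = (alpha + s%:R * (1 - alpha) / q)%:E] = q%:E.
Proof.
have /andP[al0 al1] := halpha; have /andP[q0 q1] := hq.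
have s0 : 0 < s%:R :> R by rewrite ltr0n.
pose c : R := s%:R * (1 - alpha) / q.
have c0 : 0 < c by rewrite divr_gt0// mulr_gt0// subr_gt0.
(* Outcome 0 means that no coordinate is chosen, outcome i.+1 that i is. *)
pose p (k : nat) : R := if k is 0%N then 1 - q else q / s%:R.
have p0 k : 0 <= p k.
  by case: k => [|k] /=; rewrite ?subr_ge0 ?divr_ge0// ltW.
have p1 : \sum_(k < s.+1) p k = 1.
  rewrite big_ord_recl /= sumr_const card_ord.
  rewrite -[(q / _) *+ _]mulr_natr divfK ?gt_eqF//.
  by rewrite subrK.
(* Outcomes are natural numbers; the sigma-algebra on [nat] is discrete, so measurability is
   immediate. Outcomes above [s] have mass zero. *)
have [P [PE EE]] := finitely_supported_probability _ nat R s.+1 id p p0 p1.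
pose a (w : nat) (i : 'I_s) : R := alpha + c *+ (w == i.+1).
have aal w i : alpha <= a w i by rewrite lerDl mulrn_wge0// ltW.
have a0 w i : 0 <= a w i by exact: le_trans (ltW al0) (aal w i).
exists _, nat, P, s, s, (fun w => sqrt_diag (a w)); split; [split|].
- by split; rewrite ?hs ?leqnn ?al0 ?lexx ?ltr01 ?ltW.
- by move=> i j.
- move=> i j; under [X in ('E_P[X])%E]eq_fun do rewrite sqrt_diag_mul_tr//.
  rewrite EE//; last by move=> w; rewrite mulrn_wge0.
  congr EFin; rewrite mxE; have [_|_] := eqVneq i j; last first.
    by rewrite big1// => k _; rewrite mulr0.
  under eq_bigr do rewrite mulr1n /a mulrDr.
  rewrite big_split/= -mulr_suml p1 mul1r.
  (* Only outcome [i.+1] raises entry [i], which adds [q / s%:R * c = 1 - alpha] to the mean. *)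
  rewrite big_ord_recl/= mulr0 add0r (bigD1 i)//= eqxx big1 => [|k].
    rewrite addr0 mulr1n mulrC mulrA divfK ?gt_eqF// mulrC.
    by rewrite mulKf ?gt_eqF// subrKC.
  by move/negbTE => ki; rewrite eqSS (inj_eq val_inj) ki mulr0.
(* By [aal] the lower bound holds at every outcome, so the event is the whole space. *)
- move=> V _; rewrite [X in P X](_ : _ = [set: nat]) ?probability_setT ?subr0//.
  apply/seteqP; split=> // w _ x _.
  rewrite l2norm_sqrt_diag// l2norm_sqr mulr_sumr ler_sum// => i _.
  by rewrite ler_wpM2r ?sqr_ge0.
(* At outcome 0 all diagonal entries equal [alpha], so any index is a maximiser; the supremum
   [alpha] misses the target because [c] is positive. *)
pose i0 : 'I_s := Ordinal hs.
rewrite PE big_ord_recl/= memNset ?mulr0 ?add0r; last first.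
  rewrite /= (sup_rayleigh_sqrt_diag _ (a0 0%N) i0)// => -[].
  by rewrite /a/= addr0 -/c -[LHS]addr0 => /addrI/eqP; rewrite lt_eqF.
(* At outcome [k.+1] the largest entry is the one at [k], equal to [alpha + c], so all [s] of these
   outcomes lie in the event. *)
under eq_bigr => k _.
  rewrite mem_set ?mulr1; last first.
    rewrite /= (sup_rayleigh_sqrt_diag _ (a0 k.+1) k).
      by rewrite /a eqxx mulr1n.
    by move=> i; rewrite /a eqxx lerD2l; case: eqP => // _; rewrite ltW.
  over.
by rewrite sumr_const card_ord -[(q / _) *+ _]mulr_natr divfK// gt_eqF.
Qed.
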